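(* For every integer $n\ge 0$, the sum over all $P\in\mathbf{B}_n$ of $t^{d(P)}$, where $d(P)$ is the number of down-steps of $P$, equals $$a_n(t) = \sum_{j=0}^{\lfloor n/2 \rfloor} \left( \binom{n}{j} - \binom{n}{j-1} \right) t^j.$$
   Context: $\mathbf{B}_n$ denotes the set of all Motzkin paths of length $n$ with no horizontal steps at positive heights: lattice paths from $(0,0)$ to $(n,0)$ that never go below the $x$-axis and consist of $n$ steps, each an up-step $(1,1)$, a down-step $(1,-1)$ or a horizontal step $(1,0)$, where horizontal steps occur only at height $0$. Here $t$ is an indeterminate and $\binom{n}{-1}=0$. *)

(* Defs.v *)
From HB Require Import structures.
From mathcomp Require Import all_boot all_order all_algebra.
Set Implicit Arguments.
Unset Strict Implicit.
Unset Printing Implicit Defensive.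
Import Order.TTheory GRing.Theory Num.Theory.
Local Open Scope ring_scope.

Inductive step : predArgType := Up | Down | Horiz.

Definition step_code (s : step) : option bool :=
  match s with Up => Some true | Down => Some false | Horiz => None end.

Definition step_decode (o : option bool) : step :=
  match o with Some true => Up | Some false => Down | None => Horiz end.

Lemma step_codeK : cancel step_code step_decode.
Proof. by case. Qed.

HB.instance Definition _ := Finite.copy step (can_type step_codeK).

Definition rise (s : step) : int :=
  match s with Up => 1 | Down => -1 | Horiz => 0 end.

(* A path from (0,0) is given by its sequence of steps; after i steps it is
   at the lattice point (i, height P i). *)
Definition height (P : seq step) (i : nat) : int :=
  \sum_(s <- take i P) rise s.

Definition Motzkin (n : nat) (P : n.-tuple step) : bool :=
  [forall i : 'I_n.+1, 0 <= height P i] && (height P n == 0).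

Definition B (n : nat) : {set n.-tuple step} :=
  [set P : n.-tuple step | Motzkin P &
     [forall i : 'I_n, (tnth P i == Horiz) ==> (height P i == 0)]].

Definition downs (n : nat) (P : n.-tuple step) : nat := count_mem Down P.

(* Binomial coefficient with an integer lower index, 0 when it is negative. *)
Definition binz (n : nat) (k : int) : int :=
  match k with Posz j => ('C(n, j))%:Z | Negz _ => 0 end.

Definition a (n : nat) : {poly int} :=
  \sum_(0 <= j < (n %/ 2).+1) (binz n j%:Z - binz n (j%:Z - 1)) *: 'X^j.

(* Main.v *)
Require Import Defs.
From mathcomp Require Import all_boot all_order all_algebra.
From mathcomp Require Import zify.
Import Order.TTheory GRing.Theory Num.Theory.
Local Open Scope ring_scope.

(** For a starting height [h >= 0], let [excursion_gf h n] enumerate by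
    down-steps the [n]-step paths from height [h] to height [0] that obey the
    same rules as those of [B n].  The coefficient of ['X^(u + h)] counts the
    paths with [u] up-steps and [u + h] down-steps; turn each of their
    horizontal steps into a down-step.  As horizontal steps occur only at
    height [0], the result is an up/down path that ends at its minimum, and
    this minimum is at most [0]; the horizontal steps are recovered as the
    steps to a new negative minimum.  Read backwards, it is a ballot path with
    [u] down-steps and [n - u] up-steps, and there are ['C(n, u) - 'C(n, u-1)]
    of these; ending at or below [0] means [2 * u + h <= n].

    The proof checks this closed form ([coef_excursion_gf]) by induction on
    [n].  Removing the first step gives [excursion_gfS], which on coefficients
    is Pascal's rule for ballot numbers ([ballotS]).  At height [0] there is a
    boundary case, settled by the vanishing of the ballot number for
    [2 * u = n + 1] ([ballot_boundary]).  The theorem is the case [h = 0]. *)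

(** * Paths from an arbitrary starting height *)

(** The starting height is an integer so that all three steps are treated
    alike; no path starts below the axis. *)
Fixpoint excursion (h : int) (P : seq step) : bool :=
  if P is s :: P' then
    [&& 0 <= h, (s == Horiz) ==> (h == 0) & excursion (h + rise s) P']
  else h == 0.

Lemma excursion_lt0 h P : h < 0 -> excursion h P = false.
Proof. by case: P => [|s P] /= h0; [apply/eqP; lia | rewrite leNgt h0]. Qed.

Lemma height0 P : height P 0 = 0.
Proof. by rewrite /height take0 big_nil. Qed.

Lemma height_cons s P i : height (s :: P) i.+1 = rise s + height P i.
Proof. by rewrite /height /= big_cons. Qed.

Lemma excursionP h P :
  reflect [/\ forall i, (i <= size P)%N -> 0 <= h + height P i,
              h + height P (size P) = 0
            & forall i, (i < size P)%N -> nth Horiz P i = Horiz ->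
                h + height P i = 0]
          (excursion h P).
Proof.
elim: P h => [|s P IHP] h /=.
  apply: (iffP eqP) => [-> | [_ <- _]]; last by rewrite height0 addr0.
  by split=> [[]||[]] //; rewrite height0.
apply: (iffP and3P) => [[h_ge0 /implyP flat /IHP[ge0 end0 horiz0]] | ].
  split=> [[_|i le_i]||[_ /= ?|i lt_i /= ?]];
    rewrite ?height0 ?addr0 ?height_cons ?addrA //.
  - exact: ge0.
  - by apply/eqP/flat/eqP.
  - exact: horiz0.
case=> ge0 end0 horiz0; split.
- by have := ge0 0 isT; rewrite height0 addr0.
- by apply/implyP=> /eqP flat; have := horiz0 0 isT flat; rewrite height0 addr0 => ->.
apply/IHP; split=> [i le_i||i lt_i flat]; rewrite -addrA -height_cons //.
- exact: ge0.
- exact: horiz0.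
Qed.

Lemma in_B n (P : n.-tuple step) : (P \in B n) = excursion 0 P.
Proof.
rewrite inE /Motzkin; apply/idP/excursionP; rewrite size_tuple.
  case/andP=> /andP[/forallP ge0 /eqP end0] /forallP horiz0.
  split=> [i le_i||i lt_i flat]; rewrite add0r //.
    by have := ge0 (Ordinal (le_i : (i < n.+1)%N)).
  have /implyP := horiz0 (Ordinal lt_i).
  by rewrite (tnth_nth Horiz) /= flat => /(_ isT)/eqP.
case=> ge0 end0 horiz0; rewrite -andbA; apply/and3P; split.
- by apply/forallP=> i; have := ge0 i (leq_ord i); rewrite add0r.
- by move: end0; rewrite add0r => ->.
apply/forallP=> i; apply/implyP; rewrite (tnth_nth Horiz) => /eqP flat.
by have := horiz0 i (ltn_ord i) flat; rewrite add0r => ->.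
Qed.

(** * The first-step recurrence *)

Definition excursion_gf (h : int) (n : nat) : {poly int} :=
  \sum_(P : n.-tuple step | excursion h P) 'X^(downs P).

Lemma excursion_gf_lt0 h n : h < 0 -> excursion_gf h n = 0.
Proof. by move=> h0; apply: big_pred0 => P; rewrite excursion_lt0. Qed.

Lemma excursion_gf0 h : excursion_gf h 0 = (h == 0)%:R.
Proof.
rewrite /excursion_gf (eq_bigl (fun=> h == 0)) => [|P]; last by rewrite tuple0.
case: (h == 0); last by rewrite big_pred0_eq.
by rewrite (big_pred1 [tuple]) => [|P]; rewrite ?[P]tuple0 ?eqxx.
Qed.

Lemma sum_step (V : nmodType) (F : step -> V) :
  \sum_s F s = F Up + F Down + F Horiz.
Proof.
rewrite (bigD1 Up) // (bigD1 Down) // (bigD1 Horiz) //= big_pred0; last by case.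
by rewrite addr0 addrA.
Qed.

Lemma sum_cons_tuple (T : finType) (V : nmodType) n (p : pred (seq T))
    (F : seq T -> V) :
  \sum_(P : n.+1.-tuple T | p P) F P =
  \sum_(x : T) \sum_(P : n.-tuple T | p (x :: P)) F (x :: P).
Proof.
rewrite pair_big_dep /=.
rewrite (reindex (fun q : T * n.-tuple T => [tuple of q.1 :: q.2])) //=.
exists (fun P : n.+1.-tuple T => (thead P, [tuple of behead P])) => [[x P] _|P _] /=.
  by congr (_, _); apply: val_inj.
by rewrite -tuple_eta.
Qed.

Lemma excursion_gfS (h n : nat) :
  excursion_gf h n.+1 =
    excursion_gf h.+1 n + 'X * excursion_gf (h%:Z - 1) n
    + (if h == 0%N then excursion_gf 0 n else 0).
Proof.
rewrite /excursion_gf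
  (sum_cons_tuple _ _ _ (excursion h) (fun P => 'X^(count_mem Down P))).
rewrite sum_step /=; congr (_ + _ + _).
- by apply: eq_bigl => P; rewrite intS addrC.
- by rewrite mulr_sumr; apply: eq_bigr => P _; rewrite -exprS.
by case: h => [|h]; [apply: eq_bigl | rewrite big_pred0].
Qed.

(** * Ballot numbers *)

Definition ballot (n u : nat) : int := binz n u%:Z - binz n (u%:Z - 1).

Lemma ballot0 n : ballot n 0 = 1.
Proof. by rewrite /ballot /= bin0. Qed.

Lemma ballot_succ n u : ballot n u.+1 = 'C(n, u.+1)%:Z - 'C(n, u)%:Z.
Proof. by rewrite /ballot intS addrAC subrr add0r. Qed.

Lemma ballotS n u : ballot n.+1 u.+1 = ballot n u.+1 + ballot n u.
Proof.
case: u => [|u]; rewrite ?ballot0 !ballot_succ ?bin0 !binS ?bin0; lia.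
Qed.

Lemma ballot_boundary u : ballot u.*2.+1 u.+1 = 0.
Proof.
rewrite ballot_succ -(bin_sub (m := u)); last by rewrite -addnn; lia.
by rewrite (_ : u.*2.+1 - u = u.+1)%N ?subrr //; lia.
Qed.

(** * The closed form *)

(** The bound [k.*2 <= n + h] is [2 * u + h <= n] for [u = k - h]. *)
Lemma coef_excursion_gf n (h k : nat) :
  (excursion_gf h n)`_k =
    if (h <= k)%N && (k.*2 <= n + h)%N then ballot n (k - h) else 0.
Proof.
elim: n h k => [|n IHn] h k.
  rewrite excursion_gf0 eqz_nat; case: h => [|h] /=.
    by rewrite coef1; case: k => [|k] //=; rewrite ballot0.
  by rewrite coef0; case: ifP => //; lia.
rewrite excursion_gfS !coefD IHn.
case: h => [|h] /=.
  rewrite excursion_gf_lt0 // mulr0 coef0 addr0 (IHn 0%N) /= !addn0 !subn0.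
  case: k => [|k]; first by rewrite add0r !ballot0.
  rewrite subn1 /= ballotS.
  case: ifP => c1; case: ifP => c2; case: ifP => c3; try lia.
  (* The bounds for an up-step and for a horizontal step differ only here. *)
  have -> : n = k.*2.+1 by lia.
  by rewrite ballot_boundary; lia.
rewrite (_ : h.+1%:Z - 1 = h); last by lia.
rewrite coef0 addr0.
case: k => [|k]; first by rewrite coefXM /= addr0.
have -> : ('X * excursion_gf h n)`_k.+1 = (excursion_gf h n)`_k by rewrite coefXM.
rewrite IHn !subSS.
have [lt_hk|lt_kh|->] := ltngtP h k.
- have -> : (k - h = (k - h.+1).+1)%N by lia.
  rewrite ballotS.
  by case: ifP => c1; case: ifP => c2; case: ifP => c3; lia.
- by rewrite !ifF ?addr0 //; lia.
rewrite subnn !ballot0 ltnn ltnSn !andTb add0r.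
by congr (if _ then _ else _); lia.
Qed.

Theorem mainTheorem4 (n : nat) :
  \sum_(P in B n) 'X^(downs P) = a n :> {poly int}.
Proof.
rewrite (eq_bigl _ _ (@in_B n)) -/(excursion_gf 0%N n).
apply/polyP=> k; rewrite coef_excursion_gf addn0 subn0.
rewrite /a big_mkord -(poly_def _ (ballot n)) coef_poly ltnS.
by congr (if _ then _ else _); rewrite leq_divRL // muln2.
Qed.
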